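(* Let $k\ge 2$, $0\le l\le k$ be integers, and let $T$ be a tree of order $n>k$ with $T\not\cong K_{1,n-1}$. Suppose $T$ is in $\sigma$-form with respect to $(X,Y,Z,P)$ and let $T'=\sigma(T)$. Then $\bar{\varepsilon}_{k,l}(T)\ge \bar{\varepsilon}_{k,l}(T')$.
   Context: For a tree $G$ and $S\subseteq V(G)$, $d_G(S)$ is the number of edges of the minimal subtree of $G$ containing $S$. For an $l$-subset $S$ of $V(G)$ ($n=|V(G)|$), $\varepsilon_{k,l}(S;G)=\max\{d_G(S'): S\subseteq S'\subseteq V(G),\ |S'|=k\}$, and $\bar{\varepsilon}_{k,l}(G)=\binom{n}{l}^{-1}\sum_{|S|=l}\varepsilon_{k,l}(S;G)$. For a subtree $H$ of a tree $G$ and $v\in V(H)$, $\varepsilon_H(v)=\max\{d_G(u,v):u\in V(H)\}$. A tree $T$ is in $\sigma$-form with respect to $(X,Y,Z,P)$ if $T$ is the union of a path $P$ from $v_0$ to $v_s$ of length $s\ge1$ and subtrees $X,Y,Z$ such that $Y$ contains $v_0$, $X$ and $Z$ contain $v_s$, $V(Y)\cap V(P)=\{v_0\}$, $V(X)\cap V(P)=V(Z)\cap V(P)=V(X)\cap V(Z)=\{v_s\}$, $Y$ is disjoint from $X\cup Z$, $Z$ has a vertex other than $v_s$ ($X=\{v_s\}$ is allowed), $\varepsilon_Y(v_0)\ge\max\{\varepsilon_X(v_s),\varepsilon_Z(v_s)\}$, and $|V(Y)|\ge |V(X)|$. The $\sigma$-transformation produces $\sigma(T)$ by moving $Z$ from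 $v_s$ to $v_0$: every edge $v_sz$ with $z\in V(Z)\setminus\{v_s\}$ is replaced by the edge $v_0z$ (so $V(\sigma(T))=V(T)$). The inverse operation (moving $Z$ from $v_0$ back to $v_s$) is the $\sigma^{-1}$-transformation. *)

(* Defs.v *)
From mathcomp Require Import all_boot all_order all_algebra.

Set Implicit Arguments.
Unset Strict Implicit.
Unset Printing Implicit Defensive.

(* A finite graph is a pair (vertices, edges) inside an ambient finite type V
   of possible vertices; an edge is a two-element set of vertices.  Trees,
   their subtrees and paths are all graphs in the same V, hence comparable. *)
Definition graph (V : finType) : Type := ({set V} * {set {set V}})%type.

Definition vertices (V : finType) (G : graph V) : {set V} := G.1.
Definition edges (V : finType) (G : graph V) : {set {set V}} := G.2.

Definition is_graph (V : finType) (G : graph V) : bool :=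
  [forall A in edges G, (#|A| == 2) && (A \subset vertices G)].

Definition adjacent (V : finType) (G : graph V) : rel V :=
  fun x y => [set x; y] \in edges G.

Definition subgraph (V : finType) (H G : graph V) : bool :=
  (vertices H \subset vertices G) && (edges H \subset edges G).

Definition union (V : finType) (G H : graph V) : graph V :=
  (vertices G :|: vertices H, edges G :|: edges H).

Definition connected (V : finType) (G : graph V) : bool :=
  [forall x in vertices G, forall y in vertices G, connect (adjacent G) x y].

(* The bound size c <= #|V| costs nothing, since the vertices of a cycle are
   pairwise distinct: see acyclicP.  Closed duplicate-free sequences [:: x; y]
   just run back and forth along an edge, so they are not cycles of G. *)
Definition acyclic (V : finType) (G : graph V) : bool :=
  [forall c : {bseq #|V| of V}, ucycleb (adjacent G) c ==> (size c <= 2)].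

Lemma acyclicP (V : finType) (G : graph V) :
  reflect (forall c : seq V, ucycle (adjacent G) c -> size c <= 2) (acyclic G).
Proof.
apply: (iffP forallP) => [acG c ucyc | acG c]; last by apply/implyP/acG.
have sz_c : size c <= #|V|.
  by case/andP: ucyc => _ /card_uniqP <-; apply: max_card.
by have /implyP := acG (Bseq sz_c); apply.
Qed.

Definition is_tree (V : finType) (G : graph V) : bool :=
  [&& is_graph G, vertices G != set0, connected G & acyclic G].

Definition subtree (V : finType) (H G : graph V) : bool :=
  is_tree H && subgraph H G.

(* Steiner distance d_G(S): the number of edges of a smallest subtree of the
   tree G containing S (G itself is the default candidate).  It is 0 for
   S = set0, a smallest subtree then being a single vertex. *)
Definition steiner (V : finType) (G : graph V) (S : {set V}) : nat :=
  #|edges [arg min_(H < G | subtree H G && (S \subset vertices H)) #|edges H|]|.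

(* epsilon_{k,l}(S;G), where l = #|S| *)
Definition steiner_ecc (V : finType) (k : nat) (S : {set V}) (G : graph V)
  : nat :=
  \max_(S' : {set V} |
      [&& S \subset S', S' \subset vertices G & #|S'| == k]) steiner G S'.

Definition avg_steiner_ecc (V : finType) (k l : nat) (G : graph V) : rat :=
  (('C(#|vertices G|, l)%:R)^-1 *
    \sum_(S : {set V} | (S \subset vertices G) && (#|S| == l))
       (steiner_ecc k S G)%:R)%R.

(* Length of a shortest walk from u to v; meaningful when u and v are
   connected in G, and a shortest walk then has fewer than #|V| edges. *)
Definition dist (V : finType) (G : graph V) (u v : V) : nat :=
  size [arg min_(p < [bseq] : {bseq #|V| of V} |
          path (adjacent G) u p && (last u p == v)) size p].

(* epsilon_H(v) for a subtree H of the tree G *)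
Definition ecc (V : finType) (G H : graph V) (v : V) : nat :=
  \max_(u in vertices H) dist G u v.

(* The path u, p_1, ..., p_s as a graph; zip pairs consecutive vertices. *)
Definition path_graph (V : finType) (u : V) (p : seq V) : graph V :=
  ([set x in u :: p],
   [set A in [seq [set a.1; a.2] | a <- zip (u :: p) p]]).

Definition is_path (V : finType) (P : graph V) (u v : V) (s : nat) : Prop :=
  exists p : seq V,
    [/\ uniq (u :: p), last u p = v, size p = s & P = path_graph u p].

Record sigma_form (V : finType) (T X Y Z P : graph V) (v0 vs : V) (s : nat)
  : Prop := SigmaForm {
  sf_path : is_path P v0 vs s;
  sf_length : 1 <= s;
  sf_subtreeX : subtree X T;
  sf_subtreeY : subtree Y T;
  sf_subtreeZ : subtree Z T;
  sf_union : T = union (union P X) (union Y Z);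
  sf_v0Y : v0 \in vertices Y;
  sf_vsX : vs \in vertices X;
  sf_vsZ : vs \in vertices Z;
  sf_YP : vertices Y :&: vertices P = [set v0];
  sf_XP : vertices X :&: vertices P = [set vs];
  sf_ZP : vertices Z :&: vertices P = [set vs];
  sf_XZ : vertices X :&: vertices Z = [set vs];
  sf_YXZ : [disjoint vertices Y & vertices X :|: vertices Z];
  sf_Z_nontrivial : exists2 z, z \in vertices Z & z != vs;
  sf_ecc : maxn (ecc T X vs) (ecc T Z vs) <= ecc T Y v0;
  sf_card : #|vertices X| <= #|vertices Y|
}.

Definition sigma (V : finType) (T Z : graph V) (v0 vs : V) : graph V :=
  let N := [set z in vertices Z :\ vs | adjacent T vs z] in
  (vertices T,
   (edges T :\: [set [set vs; z] | z in N]) :|: [set [set v0; z] | z in N]).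

Definition isomorphic (V W : finType) (G : graph V) (H : graph W) : Prop :=
  exists f : V -> W,
    [/\ {in vertices G &, injective f},
        f @: vertices G = vertices H &
        {in vertices G &, forall x y, adjacent H (f x) (f y) = adjacent G x y}].

Definition complete_bipartite (a b : nat) : graph ('I_a + 'I_b)%type :=
  ([set: 'I_a + 'I_b],
   [set [set (inl i : 'I_a + 'I_b); inr j] | i in 'I_a, j in 'I_b]).

(* Main.v *)
(* Deleting an edge of a tree splits its vertices in two, and d_T(S) counts the
   edges whose deletion separates two vertices of S.  An edge of X, Y or Z cuts
   the vertex set in the same way in T and in sigma(T); an edge of P has Z on
   the side of vs in T and on the side of v0 in sigma(T).  So only the edges of
   P make a difference.

   If l < k, then eps(S; T) >= eps(S; sigma(T)) holds for every S.  Let S' be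
   optimal for S in sigma(T).  If S' misses Z - vs or meets Y - v0, then S'
   does at least as well in T.  Otherwise exchange some w in S' - S for a vertex
   y of Y farthest from v0: S' misses Y - v0, so y contributes all of the
   eps_Y(v0) edges between v0 and y, while dropping w loses at most
   d(vs, w) <= eps_Y(v0) edges outside P.

   If l = k, sum over all k-sets S.  The number of k-sets that an edge splits
   depends only on the sizes a, b of its two sides: it is
   C(n,k) - C(a,k) - C(b,k).  For the edges of P this leaves an inequality
   between binomial coefficients which is the convexity of a |-> C(a,k), as
   |X| <= |Y|. *)
Require Import Defs.
From mathcomp Require Import all_boot all_order all_algebra.
From mathcomp Require Import zify.

Set Implicit Arguments.
Unset Strict Implicit.
Unset Printing Implicit Defensive.

(** * Cuts of the vertex set and the sets they split *)

Definition splits (V : finType) (B S : {set V}) : bool :=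
  ~~ (S \subset B) && ~~ [disjoint S & B].

(* [cut i] is one side of the bipartition obtained by deleting the edge
   [edge i]: that edge is the only one that crosses it. *)
Definition cut_system (V I : finType) (G : graph V) (D : {set I})
    (edge cut : I -> {set V}) : Prop :=
  edges G = edge @: D /\
  {in D &, forall i j, splits (cut i) (edge j) = (i == j)}.

Lemma splitsP (V : finType) (B S : {set V}) :
  reflect (exists x y, [/\ x \in S, y \in S, x \in B & y \notin B])
          (splits B S).
Proof.
apply: (iffP andP) => [[/subsetPn[y yS yB]] | [x [y [xS yS xB yB]]]].
  by rewrite -setI_eq0 => /set0Pn[x /setIP[xS xB]]; exists x, y.
split; first by apply/subsetPn; exists y.
by rewrite -setI_eq0; apply/set0Pn; exists x; rewrite inE xS.
Qed.

Lemma splits2 (V : finType) (B : {set V}) x y :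
  splits B [set x; y] = ((x \in B) != (y \in B)).
Proof.
rewrite /splits subUset !sub1set -setI_eq0 setIUl setU_eq0 !setI_eq0.
rewrite !disjoints1.
by case: (x \in B); case: (y \in B).
Qed.

Lemma splitsC (V : finType) (B S : {set V}) : splits (~: B) S = splits B S.
Proof. by rewrite /splits subsetC !disjoints_subset setCK andbC subsetC. Qed.

Lemma cut_system_inj (V I : finType) (G : graph V) (D : {set I}) edge cut :
  cut_system G D edge cut -> {in D &, injective edge}.
Proof.
move=> [_ cutP] i j iD jD eq_ij.
by apply/eqP; rewrite -cutP // -eq_ij cutP.
Qed.

Lemma adjacent_sym (V : finType) (G : graph V) : symmetric (adjacent G).
Proof. by move=> x y; rewrite /adjacent setUC. Qed.

Lemma connect_adjacent_sym (V : finType) (G : graph V) :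
  connect_sym (adjacent G).
Proof. exact/sym_connect_sym/adjacent_sym. Qed.

Lemma edgeP (V : finType) (G : graph V) A : is_graph G -> A \in edges G ->
  exists x y, [/\ x != y, A = [set x; y], x \in vertices G & y \in vertices G].
Proof.
move=> /forall_inP grG /grG /andP[/cards2P[x [y [neq_xy eA]]]].
by rewrite eA subUset !sub1set => /andP[xG yG]; exists x, y; split=> //.
Qed.

Lemma splits_connect (V : finType) (G : graph V) (B : {set V}) x y :
    connect (adjacent G) x y -> splits B [set x; y] ->
  exists2 A, A \in edges G & splits B A.
Proof.
case/connectP=> p + ->; elim: p x => [|z p IHp] x /=.
  by rewrite splits2 eqxx.
case/andP=> xz /IHp IH sxl; case: (boolP (splits B [set x; z])) => [|sxz].
  by exists [set x; z].
by apply: IH; move: sxl sxz; rewrite !splits2 negbK => + /eqP <-.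
Qed.

Lemma splits_connected (V : finType) (G : graph V) (B S : {set V}) :
    connected G -> S \subset vertices G -> splits B S ->
  exists2 A, A \in edges G & splits B A.
Proof.
move=> /forall_inP coG /subsetP SG /splitsP[x [y [xS yS xB yB]]].
apply: (@splits_connect _ _ _ x y); last by rewrite splits2 xB (negPf yB).
by move/forall_inP: (coG x (SG x xS)); apply; apply: SG.
Qed.

(** A path changes sides of [cut i] only along [edge i], which it cannot use while avoiding the end
    [x] of that edge. *)
Lemma path_avoid_same_side (V I : finType) (G : graph V) (D : {set I})
    edge cut i x u p :
    cut_system G D edge cut -> i \in D -> x \in edge i ->
    path (adjacent G) u p -> x \notin u :: p ->
  {in u :: p, forall v, (v \in cut i) = (u \in cut i)}.
Proof.
move=> [eqE cutP] iD xi; elim: p u => [|z p IHp] u /=.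
  by move=> _ _ v; rewrite inE => /eqP->.
case/andP=> uz pth; rewrite inE negb_or => /andP[xu xzp] v.
rewrite inE => /predU1P[->//|/(IHp _ pth xzp) ->].
have : ~~ splits (cut i) [set u; z].
  move: uz; rewrite /adjacent eqE => /imsetP[j jD uz]; rewrite uz cutP //.
  apply: contra xu => /eqP eq_ij; move: xi; rewrite eq_ij -uz !inE.
  by case/orP=> // /eqP xz; move: xzp; rewrite xz inE eqxx.
by rewrite splits2 negbK => /eqP.
Qed.

(** If a cycle leaves [x] along [edge i] to [y], the rest of it avoids [x] and stays on the side of
    [y], so the closing edge crosses [cut i] too. It is then [edge i] itself, and a vertex of the
    cycle repeats. *)
Lemma cut_system_acyclic (V I : finType) (G : graph V) (D : {set I}) edge cut :
  cut_system G D edge cut -> acyclic G.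
Proof.
move=> cs; apply/acyclicP => -[|x [|y [|z r]]] // /andP[].
rewrite -[cycle _ _]/(path _ x (rcons [:: y, z & r] x)) rcons_path.
case/andP=> /andP[xy pth] lx /and3P[xn yn _].
rewrite /= in lx.
have [eqE cutP] := cs.
have [i iD xyi] : exists2 i, i \in D & [set x; y] = edge i.
  by move: xy; rewrite /adjacent eqE => /imsetP.
have [j jD lxj] : exists2 j, j \in D & [set last z r; x] = edge j.
  by move: lx; rewrite /adjacent eqE => /imsetP.
have side := @path_avoid_same_side _ _ _ _ _ _ i x y (z :: r) cs iD.
have lzr : last z r \in z :: r by apply: mem_last.
have lside : (last z r \in cut i) = (y \in cut i).
  by apply: side => //; [rewrite -xyi set21 | rewrite inE lzr orbT].
have : splits (cut i) [set x; y] by rewrite xyi cutP.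
rewrite splits2 -lside eq_sym -splits2 lxj cutP // => /eqP ij.
have : last z r \in [set x; y] by rewrite xyi ij -lxj set21.
case/set2P => eql; rewrite eql in lzr.
  by move: xn; rewrite [in X in ~~ X]inE lzr orbT.
by move: yn; rewrite lzr.
Qed.

(** * Distances in a tree as numbers of cuts *)

Definition restrict (V : finType) (G : graph V) (B : {set V}) : graph V :=
  (vertices G :&: B, [set A in edges G | A \subset B]).

Lemma acyclic_subgraph (V : finType) (G H : graph V) :
  edges H \subset edges G -> acyclic G -> acyclic H.
Proof.
move=> /subsetP sub /acyclicP acG; apply/acyclicP => c /andP[cyc uc].
apply: acG; rewrite /ucycle /ucycleb uc andbT; apply: sub_cycle cyc.
by move=> x y; apply: sub.
Qed.

Lemma restrict_tree (V : finType) (G : graph V) (B A : {set V}) :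
    is_tree G -> A \in edges G -> splits B A ->
    {in edges G, forall A', splits B A' -> A' = A} ->
  is_tree (restrict G B).
Proof.
case/and4P=> grG _ coG acG AE sBA uniqA.
have /splitsP[u [w [uA wA uB wB]]] := sBA.
have [uG Auw] : u \in vertices G /\ A = [set u; w].
  have [x [y [_ Axy xG yG]]] := edgeP grG AE.
  move: uA wA; rewrite Axy !inE.
  case/orP=> /eqP eqx /orP[] /eqP eqy; subst => //; try by rewrite uB in wB.
  by rewrite setUC.
apply/and4P; split.
- apply/forall_inP => A'; rewrite !inE => /andP[A'G A'B].
  move/forall_inP: grG => /(_ A' A'G) /andP[-> A'V] /=.
  by rewrite subsetI A'V.
- by apply/set0Pn; exists u; rewrite inE uG.
- (* Retracting the far side onto the endpoint u of A keeps walks in B. *)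
  pose f x := if x \in B then x else u.
  have fadj x y : adjacent G x y ->
      connect (adjacent (restrict G B)) (f x) (f y).
    rewrite /f => xy.
    have cross a b : adjacent G a b -> a \in B -> b \notin B -> a = u.
      move=> ab aB bB; have := uniqA _ ab.
      rewrite splits2 aB (negPf bB) => /(_ isT).
      by move=> /setP/(_ a); rewrite Auw !inE eqxx => /esym/orP[] /eqP // eqa;
         rewrite -eqa aB in wB.
    case: ifPn => xB; case: ifPn => yB //.
    + by apply: connect1; rewrite /adjacent inE [_ \in _]xy subUset !sub1set xB.
    + by rewrite (cross x y).
    + by rewrite (cross y x) // adjacent_sym.
  have fcon x y : connect (adjacent G) x y ->
      connect (adjacent (restrict G B)) (f x) (f y).
    case/connectP => p + ->; elim: p x => //= z p IHp x /andP[/fadj xz /IHp].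
    exact: connect_trans.
  apply/forall_inP => x /setIP[xG xB]; apply/forall_inP => y /setIP[yG yB].
  have /forall_inP/(_ _ xG)/forall_inP/(_ _ yG)/fcon := coG.
  by rewrite /f xB yB.
- by apply: acyclic_subgraph acG; apply/subsetP => A'; rewrite inE => /andP[].
Qed.

(** An edge whose cut splits [S] lies in every subtree containing [S]: the subtree is connected, and
    no other edge crosses that cut. Minimality excludes all other edges. *)
Lemma steiner_cuts (V I : finType) (G : graph V) (D : {set I}) edge cut
    (S : {set V}) :
    is_tree G -> cut_system G D edge cut -> S \subset vertices G ->
  steiner G S = #|[set i in D | splits (cut i) S]|.
Proof.
move=> trG cs SG; have [eqE cutP] := cs; rewrite /steiner.
case: arg_minnP => [|H /andP[/andP[trH /andP[HG EH]] SH] minH].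
  by rewrite SG /subtree trG /subgraph !subxx.
rewrite -(card_in_imset (f := edge)); last first.
  by apply: sub_in2 (cut_system_inj cs) => i; rewrite inE => /andP[].
have [grH _ coH acH] := and4P trH.
apply: eq_card => A; apply/idP/imsetP => [AH | [i]]; last first.
  rewrite inE => /andP[iD spl] ->.
  have [A' A'H] := splits_connected coH SH spl.
  have := subsetP EH _ A'H; rewrite eqE => /imsetP[j jD A'j].
  by rewrite A'j cutP // => /eqP->; rewrite -A'j.
have := subsetP EH _ AH; rewrite eqE => /imsetP[i iD Ai].
exists i => //; rewrite inE iD /=; apply: contraLR AH => nspl; apply/negP => AH.
(* An edge of a minimal subtree H that does not separate S could be deleted
   together with the side of H that S misses. *)
pose B := if S \subset cut i then cut i else ~: cut i.
have SB : S \subset B.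
  move: nspl; rewrite /B /splits; case: ifP => //= _.
  by rewrite negbK disjoints_subset.
have cutB j : j \in D -> splits B (edge j) = (i == j).
  by move=> jD; rewrite -cutP // /B; case: ifP => //; rewrite splitsC.
have trHB : is_tree (restrict H B).
  apply: (restrict_tree (A := A)) => //; first by rewrite Ai cutB.
  move=> A' /(subsetP EH); rewrite eqE => /imsetP[j jD ->].
  by rewrite cutB // => /eqP <-.
have := minH (restrict H B); rewrite /subtree trHB /subgraph subIset ?HG //=.
rewrite subsetI SH SB !andbT leqNgt => /(_ _)/negP; apply.
  by apply/subsetP => A'; rewrite inE => /andP[/(subsetP EH)].
apply: proper_card; apply/properP; split.
  by apply/subsetP => A'; rewrite inE => /andP[].
exists A => //; rewrite inE AH /=; have := cutB i iD.
by rewrite Ai eqxx => /andP[].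
Qed.

(** The first edge, [edge i], is counted once: the rest of the path avoids [u], so it never crosses
    [cut i] again. Every other cut has [u] and [z] on the same side, so induction on the rest
    applies. *)
Lemma path_size_cuts (V I : finType) (G : graph V) (D : {set I}) edge cut u p :
    cut_system G D edge cut -> path (adjacent G) u p -> uniq (u :: p) ->
  size p = #|[set i in D | splits (cut i) [set u; last u p]]|.
Proof.
move=> cs; have [eqE cutP] := cs; elim: p u => [|z p IHp] u /=.
  move=> _ _; apply/esym/eqP; rewrite cards_eq0; apply/eqP/setP => i.
  by rewrite !inE splits2 eqxx andbF.
case/andP=> uz pth /andP[uzp uni]; rewrite (IHp z) //.
have [i iD uzi] : exists2 i, i \in D & [set u; z] = edge i.
  by move: uz; rewrite /adjacent eqE => /imsetP.
have ui : u \in edge i by rewrite -uzi set21.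
have siden := path_avoid_same_side cs iD ui pth uzp (mem_last z p).
rewrite [RHS](cardsD1 i) inE iD splits2 siden -splits2 uzi cutP // eqxx add1n.
congr _.+1; apply: eq_card => j; rewrite !inE.
have [-> | neq_ji] := eqVneq j i.
  by rewrite splits2 siden eqxx andbF.
case jD : (j \in D) => //=; rewrite !splits2.
have : ~~ splits (cut j) [set u; z] by rewrite uzi cutP.
by rewrite splits2 negbK => /eqP ->.
Qed.

Lemma dist_cuts (V I : finType) (G : graph V) (D : {set I}) edge cut u v :
    cut_system G D edge cut -> connect (adjacent G) u v ->
  dist G u v = #|[set i in D | splits (cut i) [set u; v]]|.
Proof.
move=> cs /connectP[p0 pth0 ev].
have sized p : path (adjacent G) u p -> uniq (u :: p) -> last u p = v ->
    size p = #|[set i in D | splits (cut i) [set u; v]]|.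
  by move=> pth uni <-; apply: path_size_cuts cs pth uni.
have [p [pth uni lp]] :
    exists p, [/\ path (adjacent G) u p, uniq (u :: p) & last u p = v].
  by case/shortenP: pth0 ev => p pth uni _ ->; exists p.
have szp : size p <= #|V|.
  by have := max_card (mem (u :: p)); rewrite (card_uniqP uni); apply: ltnW.
(* The default [[bseq]] need not lead from [u] to [v], so the choice is opened by hand. As [p] is a
   candidate, the branch without a minimiser is contradictory. *)
rewrite /dist /arg_min /extremum; case: pickP => [q|no_q].
  case/andP=> /andP[pthq /eqP lq] /forall_inP minq.
  apply/eqP; rewrite eqn_leq; apply/andP; split.
    by rewrite -(sized p) //; apply: (minq (Bseq szp)); rewrite /= pth lp eqxx.
  case/shortenP: pthq lq => q' pthq' uniq' sub lq'.
  rewrite -(sized q') //; apply: uniq_leq_size => //.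
  by case/andP: uniq'.
have [m Pm minm] := @arg_minnP {bseq #|V| of V} (Bseq szp)
  (fun q : {bseq #|V| of V} => path (adjacent G) u q && (last u q == v))
  (fun q : {bseq #|V| of V} => size q) ltac:(by rewrite /= pth lp eqxx).
have /negP[] := no_q m; apply/andP; split=> //.
by apply/forall_inP => q; apply: minm.
Qed.

(** * The cut system of a rooted tree *)

(* The side of the cut at the edge A that does not contain r. *)
Definition away (V : finType) (G : graph V) (r : V) (A : {set V}) : {set V} :=
  [set v | ~~ connect (adjacent (vertices G, edges G :\ A)) r v].

(** An edge other than [A] survives the deletion of [A], so its ends are both within reach of [r] or
    both not. The ends of [A] are not both in reach, which would close a cycle through [A], nor both
    out of reach, as then no edge would cross the cut although [G] connects [r] to [x]. *)
Lemma tree_cut_system (V : finType) (G : graph V) (r : V) :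
  is_tree G -> r \in vertices G ->
  cut_system G (edges G) id (away G r).
Proof.
case/and4P=> grG _ /forall_inP coG /acyclicP acG rG.
split; first by rewrite imset_id.
have nsplit A A' : A' \in edges G -> A != A' -> ~~ splits (away G r A) A'.
  move=> A'E nAA'; have [x [y [_ exy _ _]]] := edgeP grG A'E.
  have adj : adjacent (vertices G, edges G :\ A) x y.
    by rewrite /adjacent !inE /= -exy eq_sym nAA'.
  rewrite exy splits2 negbK !inE; apply/eqP; congr negb.
  apply/idP/idP => /connect_trans; apply; apply: connect1 => //.
  by rewrite adjacent_sym.
move=> A A' AE A'E; have [<-{A' A'E}|/(nsplit _ _ A'E)/negPf //] := eqVneq A A'.
have [x [y [nxy exy xG yG]]] := edgeP grG AE.
rewrite [X in splits _ X]exy splits2 !inE /=.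
set C := connect _ _; case Cx : (C x); case Cy : (C y) => //=.
  have : connect (adjacent (vertices G, edges G :\ A)) x y.
    rewrite connect_adjacent_sym (connect_trans _ Cx) //.
    by rewrite connect_adjacent_sym.
  case/connectP => p0 pth0; case/shortenP: pth0 => p pth uni _ ly.
  have /acG : ucycle (adjacent G) (x :: p).
    rewrite /ucycle uni andbT /= rcons_path -ly adjacent_sym /adjacent -exy AE.
    rewrite andbT.
    by apply: sub_path pth => a b; rewrite /adjacent !inE => /andP[].
  case: p pth ly {uni} => [|z [|]] //= => [_ exy'|].
    by rewrite exy' eqxx in nxy.
  rewrite /adjacent !inE /= => /andP[/andP[/negP nA _] _] ez.
  by case: nA; rewrite exy ez.
have rx : connect (adjacent G) r x by move/forall_inP: (coG _ rG); apply.
have [|A' A'E spl] := splits_connect (B := away G r A) rx.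
  by rewrite splits2 !inE connect0 -/(C x) Cx.
have [eA|/(nsplit _ _ A'E)/negP//] := eqVneq A A'.
by move: spl; rewrite -eA [X in splits _ X]exy splits2 !inE -/C Cx Cy.
Qed.

(** Used for the map that sends [vs] to [v0]: at an edge off [P] both lie on the same side. *)
Lemma splits_imset (V : finType) (f : V -> V) (B S : {set V}) :
  (forall x, (f x \in B) = (x \in B)) -> splits B (f @: S) = splits B S.
Proof.
move=> fB; have pre (C : {set V}) : (forall x, (f x \in C) = (x \in C)) ->
    (f @: S \subset C) = (S \subset C).
  by move=> fC; rewrite sub_imset_pre; apply: eq_subset_r => x;
     rewrite inE fC.
rewrite /splits !disjoints_subset !pre // => x; by rewrite !inE fB.
Qed.

(** * Binomial counts of split sets *)

(** For positive [k], raising the top of ['C(_, k)] by one adds ['C(_, k.-1)] by Pascal's rule, and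
    this grows with the top; [z] such steps are added up. *)
Lemma bin_convex k a b z : a <= b ->
  'C(b, k) + 'C(a + z, k) <= 'C(a, k) + 'C(b + z, k).
Proof.
move=> ab; case: k => [|k]; first by rewrite !bin0.
elim: z => [|z IHz]; first by rewrite !addn0 addnC.
rewrite !addnS !binS !addnA; apply: leq_add => //.
by apply: leq_bin2l; rewrite leq_add2r.
Qed.

(** A nonempty set not split by [B] lies within [B] or within [U :\: B], never in both. *)
Lemma card_splits (V : finType) (U B : {set V}) k : 0 < k -> B \subset U ->
  #|[set S : {set V} | [&& S \subset U, #|S| == k & splits B S]]|
    + ('C(#|B|, k) + 'C(#|U :\: B|, k)) = 'C(#|U|, k).
Proof.
move=> k0 BU; rewrite -!cards_draws -[RHS](cardsID [set S | splits B S]).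
congr (_ + _); first by apply: eq_card => S; rewrite !inE andbA.
rewrite -cardsUI [X in _ + X](_ : _ = 0) ?addn0; last first.
  apply/eqP; rewrite cards_eq0; apply/eqP/setP => S; rewrite !inE.
  apply/negP => /andP[/andP[SB /eqP Sk] /andP[/subsetDP[_ dSB] _]].
  have [x xS] : exists x, x \in S by apply/card_gt0P; rewrite Sk.
  by have := disjointFr dSB xS; rewrite (subsetP SB).
apply: eq_card => S; rewrite !inE -andb_orl andbA; congr (_ && _).
rewrite /splits subsetD negb_and !negbK andb_orl.
by case SB: (S \subset B) => //=; rewrite ?(subset_trans SB BU) // andbC.
Qed.

(** * Cutting a path at one of its edges *)

Lemma mem_path_edges (V : finType) (u : V) p A :
  reflect (exists2 i, i < size p &
             A = [set nth u (u :: p) i; nth u (u :: p) i.+1])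
          (A \in edges (path_graph u p)).
Proof.
have sz : size (zip (u :: p) p) = size p.
  by rewrite size_zip minnE subKn //= ltnW.
have nthz i : i < size p ->
    nth (u, u) (zip (u :: p) p) i = (nth u (u :: p) i, nth u p i).
  by move=> ip; rewrite nth_zip_cond sz ip.
rewrite inE; apply: (iffP mapP) => [[a /(nthP (u, u))[i]] | [i ip ->]].
  by rewrite sz => ip <- ->; exists i => //; rewrite nthz.
exists (nth u (u :: p) i, nth u p i) => //.
by rewrite -nthz // mem_nth // sz.
Qed.

(* The vertices that come after the edge A on the path q. *)
Definition beyond (V : finType) (q : seq V) (A : {set V}) : {set V} :=
  [set x in drop (find (mem A) q).+1 q].

Lemma mem_drop_index (T : eqType) (q : seq T) i x : uniq q -> x \in q ->
  (x \in drop i q) = (i <= index x q).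
Proof.
move=> uq xq; rewrite leqNgt -in_take //.
have := uq; rewrite -{1}(cat_take_drop i q) cat_uniq => /and3P[_ /hasPn dis _].
have := xq; rewrite -{1}(cat_take_drop i q) mem_cat.
case xt: (x \in take i q) => //= _; apply/negP => /dis; by rewrite /= xt.
Qed.

(** An edge is a bare set, so [beyond] has to recover its position. As the path has no repetition,
    the first vertex found in the edge is its end of index [i]. *)
Lemma find_path_edge (V : finType) (u : V) p i :
  uniq (u :: p) -> i < size p ->
  find (mem [set nth u (u :: p) i; nth u (u :: p) i.+1]) (u :: p) = i.
Proof.
set q := u :: p => uq ip; set A := [set _; _].
have hasA : has (mem A) q.
  apply/hasP; exists (nth u q i); first by apply: mem_nth; apply: ltnW.
  by rewrite /= set21.
have sq : size q = (size p).+1 by [].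
apply/eqP; rewrite eqn_leq; apply/andP; split.
  rewrite leqNgt; apply/negP => /(before_find u) /=.
  by rewrite set21.
have : nth u q (find (mem A) q) \in A by apply: (nth_find u hasA).
have fq : find (mem A) q < size q by rewrite -has_find.
rewrite in_set2.
have iq : i < size q by rewrite sq ltnW.
by rewrite !nth_uniq // => /orP[]/eqP->.
Qed.

Lemma mem_beyond (V : finType) (u : V) p i x :
    uniq (u :: p) -> i < size p -> x \in u :: p ->
  (x \in beyond (u :: p) [set nth u (u :: p) i; nth u (u :: p) i.+1])
    = (i < index x (u :: p)).
Proof. by move=> uq ip xq; rewrite inE find_path_edge // mem_drop_index. Qed.

Lemma beyond_sub (V : finType) (q : seq V) A : beyond q A \subset [set x in q].
Proof. by apply/subsetP => x; rewrite !inE; apply: mem_drop. Qed.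

Lemma card_beyond (V : finType) (u : V) p i :
    uniq (u :: p) -> i < size p ->
  #|beyond (u :: p) [set nth u (u :: p) i; nth u (u :: p) i.+1]| = size p - i.
Proof.
move=> uq ip; rewrite /beyond find_path_edge // cardsE.
by have /card_uniqP -> := drop_uniq i.+1 uq; rewrite size_drop subSS.
Qed.

(** The edge at position [j] has ends of index [j] and [j.+1], and the bound [i < _] tells these
    apart only for [j = i]. *)
Lemma splits_beyond (V : finType) (u : V) p :
  uniq (u :: p) ->
  {in edges (path_graph u p) &, forall A A',
     splits (beyond (u :: p) A) A' = (A == A')}.
Proof.
move=> uq A A' /mem_path_edges[i ip ->] /mem_path_edges[j jp ->].
have jq : j < size (u :: p) by apply: ltnW.
have memq k : k < size (u :: p) -> nth u (u :: p) k \in u :: p.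
  exact: mem_nth.
rewrite splits2 !mem_beyond ?memq // !index_uniq //.
have [->|neq_ij] := eqVneq i j; first by rewrite ltnn ltnSn eqxx.
rewrite [i < j.+1]leq_eqVlt eqSS (negPf neq_ij) /= eqxx.
apply/esym/negP => /eqP.
move/(congr1 (fun B : {set V} => find (mem B) (u :: p))).
by rewrite !find_path_edge // => /eqP; rewrite (negPf neq_ij).
Qed.

Lemma path_graph_connect (V : finType) (G : graph V) (u : V) p x :
    edges (path_graph u p) \subset edges G -> x \in u :: p ->
  connect (adjacent G) u x.
Proof.
move=> /subsetP sub; apply: path_connect; apply/(pathP u) => i ip.
by apply: sub; apply/mem_path_edges; exists i.
Qed.

Lemma dist_gt0 (V : finType) (G : graph V) u v :
  is_tree G -> u \in vertices G -> v \in vertices G -> u != v -> 0 < dist G u v.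
Proof.
move=> trG uG vG neq; have cs := tree_cut_system trG uG.
have [_ _ /forall_inP/(_ _ uG)/forall_inP/(_ _ vG) uv _] := and4P trG.
rewrite (dist_cuts cs uv); case/connectP: uv neq => p0 pth0.
case/shortenP: pth0 => p pth uni _ -> neq; rewrite -(path_size_cuts cs pth uni).
by case: p neq {pth uni} => //=; rewrite eqxx.
Qed.

(** * How the pieces of the sigma-form fit together *)

Section SigmaForm.

Variables (V : finType) (T X Y Z : graph V) (v0 vs : V) (p : seq V).
Hypotheses (trT : is_tree T) (uq : uniq (v0 :: p)) (lq : last v0 p = vs).

Local Notation q := (v0 :: p).
Local Notation P := (path_graph v0 p).
Local Notation T' := (sigma T Z v0 vs).

Hypothesis sf : sigma_form T X Y Z P v0 vs (size p).

Let grT : is_graph T. Proof. by case/and4P: trT. Qed.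
Let grX : is_graph X. Proof. by case/andP: (sf_subtreeX sf) => /and4P[]. Qed.
Let grY : is_graph Y. Proof. by case/andP: (sf_subtreeY sf) => /and4P[]. Qed.
Let grZ : is_graph Z. Proof. by case/andP: (sf_subtreeZ sf) => /and4P[]. Qed.
Let trX : is_tree X. Proof. by case/andP: (sf_subtreeX sf). Qed.
Let trY : is_tree Y. Proof. by case/andP: (sf_subtreeY sf). Qed.
Let trZ : is_tree Z. Proof. by case/andP: (sf_subtreeZ sf). Qed.

Let memT x : (x \in vertices T)
  = [|| x \in q, x \in vertices X, x \in vertices Y | x \in vertices Z].
Proof.
by rewrite (sf_union sf) /union /vertices /= !in_setU -orbA; congr (_ || _);
   rewrite inE.
Qed.

Let edgeT A : (A \in edges T)
  = [|| A \in edges P, A \in edges X, A \in edges Y | A \in edges Z].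
Proof.
by rewrite (sf_union sf) /union /edges /= !in_setU -orbA.
Qed.

Let XT A : A \in edges X -> A \in edges T.
Proof. by rewrite edgeT => ->; rewrite !orbT. Qed.
Let YT A : A \in edges Y -> A \in edges T.
Proof. by rewrite edgeT => ->; rewrite !orbT. Qed.
Let ZT A : A \in edges Z -> A \in edges T.
Proof. by rewrite edgeT => ->; rewrite !orbT. Qed.
Let PT A : A \in edges P -> A \in edges T.
Proof. by rewrite edgeT => ->. Qed.

Let vsP : vs \in q. Proof. by rewrite -lq mem_last. Qed.
Let v0Y := sf_v0Y sf.
Let vsX := sf_vsX sf.
Let vsZ := sf_vsZ sf.
Let v0T : v0 \in vertices T. Proof. by rewrite memT v0Y !orbT. Qed.

Let YPx x : x \in vertices Y -> (x \in q) = (x == v0).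
Proof. by move=> xY; have/setP/(_ x) := sf_YP sf; rewrite !inE xY. Qed.
Let XPx x : x \in vertices X -> (x \in q) = (x == vs).
Proof. by move=> xX; have/setP/(_ x) := sf_XP sf; rewrite !inE xX. Qed.
Let ZPx x : x \in vertices Z -> (x \in q) = (x == vs).
Proof. by move=> xZ; have/setP/(_ x) := sf_ZP sf; rewrite !inE xZ. Qed.
Let XZx x : x \in vertices Z -> (x \in vertices X) = (x == vs).
Proof. by move=> xZ; have/setP/(_ x) := sf_XZ sf; rewrite !inE xZ andbT. Qed.
Let YXx x : x \in vertices Y -> x \in vertices X = false.
Proof.
by move=> xY; have := disjointFr (sf_YXZ sf) xY; rewrite inE => /norP[/negPf].
Qed.
Let YZx x : x \in vertices Y -> x \in vertices Z = false.
Proof.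
by move=> xY; have := disjointFr (sf_YXZ sf) xY; rewrite inE => /norP[_ /negPf].
Qed.

Let edge_sub (G : graph V) A : is_graph G -> A \in edges G ->
  A \subset vertices G.
Proof. by move/forall_inP => grG /grG /andP[]. Qed.

Let edgeP_sub A : A \in edges P -> A \subset [set x in q].
Proof.
case/mem_path_edges => i ip ->.
by rewrite subUset !sub1set !in_set !mem_nth //; apply: ltnW.
Qed.

(** Two pieces share at most one vertex, so a common edge would have both ends there; this makes the
    edge sets of the pieces disjoint. *)
Let edge_in_one_vertex A r : A \in edges T -> ~ {subset A <= pred1 r}.
Proof.
move=> /(edgeP grT)[x [y [nxy -> _ _]]] sub.
have /eqP xr : x \in pred1 r by apply: sub; rewrite set21.
have /eqP yr : y \in pred1 r by apply: sub; rewrite set22.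
by rewrite xr yr eqxx in nxy.
Qed.

Let XnP A : A \in edges X -> A \in edges P = false.
Proof.
move=> AX; apply/negP => AP; apply: (@edge_in_one_vertex A vs (XT AX)) => x xA.
rewrite inE -XPx; last exact: (subsetP (edge_sub grX AX)).
by have := subsetP (edgeP_sub AP) _ xA; rewrite inE.
Qed.
Let YnP A : A \in edges Y -> A \in edges P = false.
Proof.
move=> AX; apply/negP => AP; apply: (@edge_in_one_vertex A v0 (YT AX)) => x xA.
rewrite inE -YPx; last exact: (subsetP (edge_sub grY AX)).
by have := subsetP (edgeP_sub AP) _ xA; rewrite inE.
Qed.
Let ZnP A : A \in edges Z -> A \in edges P = false.
Proof.
move=> AX; apply/negP => AP; apply: (@edge_in_one_vertex A vs (ZT AX)) => x xA.
rewrite inE -ZPx; last exact: (subsetP (edge_sub grZ AX)).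
by have := subsetP (edgeP_sub AP) _ xA; rewrite inE.
Qed.
Let XnZ A : A \in edges X -> A \in edges Z = false.
Proof.
move=> AX; apply/negP => AZ; apply: (@edge_in_one_vertex A vs (XT AX)) => x xA.
rewrite inE -XZx; first exact: (subsetP (edge_sub grX AX)).
exact: (subsetP (edge_sub grZ AZ)).
Qed.
Let YnX A : A \in edges Y -> A \in edges X = false.
Proof.
move=> AY; apply/negP => AX; apply: (@edge_in_one_vertex A v0 (YT AY)) => x xA.
have := subsetP (edge_sub grX AX) _ xA.
by rewrite YXx //; apply: (subsetP (edge_sub grY AY)).
Qed.
Let YnZ A : A \in edges Y -> A \in edges Z = false.
Proof.
move=> AY; apply/negP => AZ; apply: (@edge_in_one_vertex A v0 (YT AY)) => x xA.
have := subsetP (edge_sub grZ AZ) _ xA.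
by rewrite YZx //; apply: (subsetP (edge_sub grY AY)).
Qed.

Let edgeZ A z : A \in edges T -> z \in A -> z \in vertices Z -> z != vs ->
  A \in edges Z.
Proof.
rewrite edgeT => /or4P[] // AE zA zZ zvs.
- by have := subsetP (edgeP_sub AE) _ zA; rewrite inE ZPx // (negPf zvs).
- by have := subsetP (edge_sub grX AE) _ zA; rewrite XZx // (negPf zvs).
- by have := subsetP (edge_sub grY AE) _ zA => /YZx; rewrite zZ.
Qed.

Let away_adj A B : A \in edges T -> A != B ->
  A \in edges (vertices T, edges T :\ B).
Proof. by rewrite !inE => -> ->. Qed.

Let connect_away (H : graph V) A x y : connected H ->
    (forall B, B \in edges H -> B \in edges T) -> A \notin edges H ->
    x \in vertices H -> y \in vertices H ->
  connect (adjacent (vertices T, edges T :\ A)) x y.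
Proof.
move=> /forall_inP coH HT AH xH yH.
have /forall_inP/(_ _ yH) := coH _ xH; apply: connect_sub => a b ab.
apply: connect1; apply: away_adj; first exact: HT.
by apply: contraNneq AH => <-.
Qed.

Lemma path_not_away A x : A \notin edges P -> x \in q -> x \notin away T v0 A.
Proof.
move=> AP xq; rewrite inE negbK; apply: path_graph_connect xq.
apply/subsetP => B BP; apply: away_adj; first exact: PT.
by apply: contraNneq AP => <-.
Qed.

Lemma Y_not_away A x : A \notin edges Y -> x \in vertices Y ->
  x \notin away T v0 A.
Proof.
move=> AY xY; rewrite inE negbK.
by apply: (@connect_away Y) => //; case/and4P: trY.
Qed.

(** When an edge of [Y] is deleted, [P] stays attached to [v0], and [X] and [Z] hang on it at [vs],
    so only vertices of [Y] can be cut off. *)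
Lemma away_Y A x : A \in edges Y -> x \in vertices T -> x \in away T v0 A ->
  (x \in vertices Y) && (x != v0).
Proof.
move=> AY; have AP : A \notin edges P by rewrite YnP.
rewrite memT => /or4P[xq|xX|xY|xZ].
- by rewrite (negPf (path_not_away AP xq)).
- rewrite inE => /negP[]; apply: (@connect_trans _ _ vs).
    by have := path_not_away AP vsP; rewrite inE negbK.
  apply: (@connect_away X) => //; first by case/and4P: trX.
  by rewrite YnX.
- by rewrite xY /=; apply: contraTneq => ->; rewrite path_not_away ?mem_head.
- rewrite inE => /negP[]; apply: (@connect_trans _ _ vs).
    by have := path_not_away AP vsP; rewrite inE negbK.
  apply: (@connect_away Z) => //; first by case/and4P: trZ.
  by rewrite YnZ.
Qed.

(** * Cut systems of the tree and of its sigma-transform *)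

(** Sends an edge of [T] to its counterpart in [T'], so that the edges of [T] index the cuts of both
    trees. Only edges of [Z] at [vs] change. *)
Definition sigma_edge (A : {set V}) : {set V} :=
  if A \in edges Z then [set (if x == vs then v0 else x) | x in A] else A.

(** At an edge of [P] the far side is spelled out for comparison with [cutT'], where [Z] has gone
    over to the side of [v0]; elsewhere both trees use the same cut. *)
Definition cutT (A : {set V}) : {set V} :=
  if A \in edges P then vertices X :|: vertices Z :|: beyond q A
  else away T v0 A.

Definition cutT' (A : {set V}) : {set V} :=
  if A \in edges P then vertices X :|: beyond q A else away T v0 A.

Let beyond_vs A : A \in edges P -> vs \in beyond q A.
Proof.
case/mem_path_edges => i ip ->; rewrite mem_beyond // -lq.
by rewrite [last _ _](last_nth v0) index_uniq //= .
Qed.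

Let beyond_v0 A : A \in edges P -> v0 \notin beyond q A.
Proof.
by case/mem_path_edges => i ip ->; rewrite mem_beyond ?mem_head //= eqxx.
Qed.

Let beyondP A x : x \in beyond q A -> x \in q.
Proof. by move/(subsetP (beyond_sub q A)); rewrite inE. Qed.

Let cutT'_path A x : A \in edges P -> x \in q ->
  (x \in vertices X :|: beyond q A) = (x \in beyond q A).
Proof.
move=> AP xq; rewrite inE; case xX: (x \in vertices X) => //=.
by move: xq; rewrite XPx // => /eqP->; rewrite beyond_vs.
Qed.

Let cutT_path A x : A \in edges P -> x \in q ->
  (x \in vertices X :|: vertices Z :|: beyond q A) = (x \in beyond q A).
Proof.
move=> AP xq; rewrite setUAC inE cutT'_path //; case xZ: (x \in vertices Z).
  by move: xq; rewrite ZPx // => /eqP->; rewrite beyond_vs.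
by rewrite orbF.
Qed.

Let splits_eq_in (B C S : {set V}) : {in S, B =i C} -> splits B S = splits C S.
Proof.
by move=> eqBC; apply/splitsP/splitsP => -[x [y [xS yS xB yB]]]; exists x, y;
  split=> //; move: xB yB; rewrite ?eqBC.
Qed.

Let splits_sub (B S : {set V}) : S \subset B -> splits B S = false.
Proof. by rewrite /splits => ->. Qed.

Let splits_disjoint (B S : {set V}) : [disjoint S & B] -> splits B S = false.
Proof. by rewrite /splits => ->; rewrite andbF. Qed.

Let disjoint_setU (A B C : {set V}) :
  [disjoint A & B :|: C] = [disjoint A & B] && [disjoint A & C].
Proof. by rewrite -!setI_eq0 setIUr setU_eq0. Qed.

Let Y_beyond A : A \in edges P -> [disjoint vertices Y & beyond q A].
Proof.
move=> AP; apply/pred0P => x /=; apply/negP => /andP[xY xb].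
have := beyondP xb; rewrite YPx // => /eqP x0.
by move: xb; rewrite x0 (negPf (beyond_v0 AP)).
Qed.

(** At an edge of [P], the edges of [P] are compared along the path, while edges of [X] and [Z] lie
    wholly inside the cut and edges of [Y] wholly outside. *)
Lemma cut_system_T : cut_system T (edges T) id cutT.
Proof.
split=> [|A B AE BE]; first by rewrite imset_id.
rewrite /cutT; case: ifP => AP; last first.
  by have [_ ->] := tree_cut_system trT v0T.
have := BE; rewrite edgeT => /or4P[] BE'.
- rewrite -(splits_beyond uq AP BE'); apply: splits_eq_in => x xB.
  by apply: cutT_path => //; have := subsetP (edgeP_sub BE') _ xB; rewrite inE.
- rewrite splits_sub; last first.
    by rewrite -setUA subsetU // (edge_sub grX BE').
  by apply/esym/eqP => eqAB; rewrite -eqAB in BE'; rewrite XnP in AP.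
- rewrite splits_disjoint; last first.
    apply: disjointWl (edge_sub grY BE') _.
    by rewrite disjoint_setU (sf_YXZ sf) Y_beyond.
  by apply/esym/eqP => eqAB; rewrite -eqAB in BE'; rewrite YnP in AP.
- rewrite splits_sub; last first.
    by rewrite setUAC subsetU // (edge_sub grZ BE') orbT.
  by apply/esym/eqP => eqAB; rewrite -eqAB in BE'; rewrite ZnP in AP.
Qed.

Let v0Z : v0 \in vertices Z = false. Proof. exact: YZx. Qed.

Let edgeZ_vs A : A \in edges Z -> vs \in A ->
  exists z, [/\ A = [set vs; z], z \in vertices Z, z != vs & adjacent T vs z].
Proof.
move=> AZ vsA; have [x [y [nxy eA xZ yZ]]] := edgeP grZ AZ.
have AT := ZT AZ; move: vsA; rewrite eA => /set2P[] evs; [exists y | exists x].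
  by rewrite /adjacent evs -eA eq_sym.
by rewrite evs; split=> //; [exact: setUC | rewrite /adjacent setUC -eA].
Qed.

Let sigma_edge_id A : (A \in edges Z -> vs \notin A) -> sigma_edge A = A.
Proof.
rewrite /sigma_edge; case: ifP => // AZ /(_ isT) vsA.
rewrite -[RHS]imset_id; apply: eq_in_imset => x xA.
by case: eqP => // xvs; rewrite -xvs xA in vsA.
Qed.

Let sigma_edge_vs z : [set vs; z] \in edges Z -> z != vs ->
  sigma_edge [set vs; z] = [set v0; z].
Proof.
move=> AZ zvs; rewrite /sigma_edge AZ imsetU1 imset_set1 eqxx.
by rewrite (negPf zvs).
Qed.

Let moved A :
  (A \in [set [set vs; z] | z in
           [set z in vertices Z :\ vs | adjacent T vs z]])
  = (A \in edges Z) && (vs \in A).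
Proof.
apply/imsetP/andP => [[z] | [AZ vsA]].
  rewrite !inE => /andP[/andP[zvs zZ] adj] ->.
  by rewrite set21; split=> //; apply: (edgeZ adj _ zZ zvs); rewrite set22.
have [z [eA zZ zvs adj]] := edgeZ_vs AZ vsA.
by exists z => //; rewrite !inE zvs zZ.
Qed.

Let sigma_edges : edges T' = sigma_edge @: edges T.
Proof.
apply/setP => A; rewrite in_setU in_setD moved; apply/orP/imsetP.
  case=> [/andP[nmv AT] | /imsetP[z]].
    exists A => //; rewrite sigma_edge_id // => AZ.
    by move: nmv; rewrite AZ.
  rewrite !inE => /andP[/andP[zvs zZ] adj] ->; exists [set vs; z] => //.
  rewrite sigma_edge_vs //; apply: (edgeZ adj _ zZ zvs); exact: set22.
case=> B BT ->; case: (boolP ((B \in edges Z) && (vs \in B))) => [|nmv].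
  case/andP=> BZ vsB; have [z [eB zZ zvs adj]] := edgeZ_vs BZ vsB.
  right; rewrite eB sigma_edge_vs -?eB //; apply/imsetP; exists z => //.
  by rewrite !inE zvs zZ.
left; rewrite sigma_edge_id ?nmv //.
by move=> BZ; rewrite BZ in nmv.
Qed.

(** Off [P], replacing [vs] by [v0] keeps the sides, since neither is away from [v0]. At an edge of
    [P], a transformed edge of [Z] lies wholly on the side of [v0]. *)
Lemma cut_system_T' : cut_system T' (edges T) sigma_edge cutT'.
Proof.
split=> [|A B AE BE]; first exact: sigma_edges.
rewrite /cutT'; case: ifP => AP; last first.
  have [_ <-//] := tree_cut_system trT v0T.
  rewrite /sigma_edge; case: ifP => // _; apply: splits_imset => x.
  by case: eqP => // ->; rewrite !(negPf (path_not_away _ _)) ?AP ?mem_head.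
have := BE; rewrite edgeT => /or4P[] BE'.
- rewrite sigma_edge_id; last by move=> /ZnP; rewrite BE'.
  rewrite -(splits_beyond uq AP BE'); apply: splits_eq_in => x xB.
  by apply: cutT'_path => //; have := subsetP (edgeP_sub BE') _ xB; rewrite inE.
- rewrite sigma_edge_id ?XnZ // splits_sub; last first.
    by rewrite subsetU // (edge_sub grX BE').
  by apply/esym/eqP => eqAB; rewrite -eqAB in BE'; rewrite XnP in AP.
- rewrite sigma_edge_id ?YnZ // splits_disjoint; last first.
    apply: disjointWl (edge_sub grY BE') _.
    rewrite disjoint_setU Y_beyond // andbT.
    by apply/pred0P => x /=; apply/negP => /andP[/YXx->].
  by apply/esym/eqP => eqAB; rewrite -eqAB in BE'; rewrite YnP in AP.
- rewrite /sigma_edge BE' splits_disjoint; last first.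
    apply/pred0P => y /=; apply/negP => /andP[/imsetP[x xB ->]].
    have xZ := subsetP (edge_sub grZ BE') _ xB.
    case: eqP => [_|/eqP xvs]; rewrite inE; case/orP.
    + by rewrite YXx.
    + by rewrite (negPf (beyond_v0 AP)).
    + by rewrite XZx // (negPf xvs).
    + by move/beyondP; rewrite ZPx // (negPf xvs).
  by apply/esym/eqP => eqAB; rewrite -eqAB in BE'; rewrite ZnP in AP.
Qed.

(** The path between [v0] and [vs] survives, so a moved edge from [vs] to [z] is replaced by going
    along it to [v0] and on to [z]. Acyclicity comes with the cut system. *)
Lemma sigma_tree : is_tree T'.
Proof.
have vT' : vertices T' = vertices T by [].
apply/and4P; split.
- apply/forall_inP => A; rewrite vT' in_setU => /orP[|/imsetP[z]].
    by rewrite inE => /andP[_ AT]; move/forall_inP: grT; apply.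
  rewrite !inE => /andP[/andP[zvs zZ] _] ->.
  rewrite subUset !sub1set v0T memT zZ !orbT cards2.
  by rewrite (_ : v0 != z) //; apply: contraTneq zZ => <-; rewrite v0Z.
- by apply/set0Pn; exists v0.
- have keep A : A \in edges T -> (A \in edges Z -> vs \notin A) ->
      A \in edges T'.
    move=> AT nA; rewrite sigma_edges -(sigma_edge_id nA).
    exact: imset_f.
  have con0s : connect (adjacent T') v0 vs.
    apply: path_graph_connect vsP; apply/subsetP => A AP.
    by apply: keep; [exact: PT | move/ZnP; rewrite AP].
  have /forall_inP coT : connected T by case/and4P: trT.
  apply/forall_inP => x xT; apply/forall_inP => y yT.
  have /forall_inP/(_ _ yT) := coT _ xT; apply: connect_sub => a b ab.
  have [/andP[AZ vsA]|nmv] :=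
      boolP (([set a; b] \in edges Z) && (vs \in [set a; b])).
    have [z [eA zZ zvs adj]] := edgeZ_vs AZ vsA.
    have AT' : [set v0; z] \in edges T'.
      rewrite sigma_edges -(@sigma_edge_vs z) -?eA //; exact: imset_f.
    have consz : connect (adjacent T') vs z.
      rewrite connect_adjacent_sym in con0s.
      by apply: connect_trans con0s _; apply: connect1.
    have : a \in [set vs; z] by rewrite -eA set21.
    have : b \in [set vs; z] by rewrite -eA set22.
    by case/set2P=> -> /set2P[] ->; rewrite // connect_adjacent_sym.
  by apply: connect1; apply: keep => // AZ; rewrite AZ in nmv.
- exact: cut_system_acyclic cut_system_T'.
Qed.

(** * Fewer than [k] prescribed vertices: the exchange *)

(** Off [P] the two trees have the same cuts, so [outer] serves for both, whereas [inner] depends on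
    the cuts chosen. *)
Let outer (S : {set V}) :=
  #|[set A in edges T :\: edges P | splits (away T v0 A) S]|.

Let inner (cut : {set V} -> {set V}) (S : {set V}) :=
  #|[set A in edges P | splits (cut A) S]|.

(* Iterated [inE] would unfold [edges P] down to a sequence. *)
Let in_outer (Q : pred {set V}) A :
  (A \in [set B in edges T :\: edges P | Q B])
  = [&& A \notin edges P, A \in edges T & Q A].
Proof. by rewrite in_set in_setD andbA. Qed.

Let in_inner (Q : pred {set V}) A :
  (A \in [set B in edges P | Q B]) = (A \in edges P) && Q A.
Proof. by rewrite in_set. Qed.

Let card_split_edges cut (S : {set V}) :
    (forall A, A \notin edges P -> cut A = away T v0 A) ->
  #|[set A in edges T | splits (cut A) S]| = outer S + inner cut S.
Proof.
move=> cutE; rewrite -(cardsID (edges P)) addnC /outer /inner; congr (_ + _).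
  apply: eq_card => A; rewrite in_setD in_set in_outer.
  by have [|/cutE ->] := boolP (A \in edges P).
apply: eq_card => A; rewrite in_setI in_set in_inner andbC.
by have [/PT->|] := boolP (A \in edges P).
Qed.

Lemma steiner_T (S : {set V}) :
  S \subset vertices T -> steiner T S = outer S + inner cutT S.
Proof.
move/(steiner_cuts trT cut_system_T) ->; apply: card_split_edges => A.
by rewrite /cutT => /negPf->.
Qed.

Lemma steiner_T' (S : {set V}) :
  S \subset vertices T -> steiner T' S = outer S + inner cutT' S.
Proof.
move/(steiner_cuts sigma_tree cut_system_T') ->; apply: card_split_edges => A.
by rewrite /cutT' => /negPf->.
Qed.

Let far_vertex : exists y, [/\ y \in vertices Y, y != v0 &
  {in vertices X :|: vertices Z, forall w, dist T w vs <= dist T y v0}].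
Proof.
have [y yY ey] : {y | y \in vertices Y & ecc T Y v0 = dist T y v0}.
  by apply: (eq_bigmax_cond (fun u => dist T u v0)); apply/card_gt0P; exists v0.
have far : {in vertices X :|: vertices Z, forall w, dist T w vs <= dist T y v0}.
  have := sf_ecc sf; rewrite geq_max ey => /andP[ltX ltZ] w.
  by case/setUP => wH; [apply: leq_trans ltX | apply: leq_trans ltZ];
     apply: (leq_bigmax_cond (F := dist T ^~ vs)).
exists y; split=> //; apply/eqP => y0.
(* If [y] were [v0], the bound would be 0, but [Z] has a vertex at positive distance from [vs]. *)
have [z zZ zvs] := sf_Z_nontrivial sf.
have := far z; rewrite inE zZ orbT => /(_ isT); apply/negP.
rewrite -ltnNge y0 (dist_cuts cut_system_T (connect0 _ _)).
rewrite [X in X < _](_ : _ = 0); last first.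
  apply/eqP; rewrite cards_eq0; apply/eqP/setP => A.
  by rewrite !inE splits2 eqxx andbF.
by apply: dist_gt0; rewrite // ?memT ?zZ ?vsP ?orbT.
Qed.

Let connT x y : x \in vertices T -> y \in vertices T ->
  connect (adjacent T) x y.
Proof.
by case/and4P: trT => _ _ /forall_inP coT _ /coT /forall_inP; apply.
Qed.

(** An edge off [P] that cuts [w] off from [v0] also cuts it off from [vs], for [P] stays in one
    piece. *)
Let card_outer_from_vs w : w \in vertices T ->
  #|[set A in edges T :\: edges P | w \in away T v0 A]| <= dist T w vs.
Proof.
move=> wT; have vsT : vs \in vertices T by rewrite memT vsP.
rewrite (dist_cuts (tree_cut_system trT v0T) (connT wT vsT)).
apply: subset_leq_card; apply/subsetP => A.
rewrite in_outer in_set => /and3P[AP AT wA].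
by rewrite AT splits2 (negPf (path_not_away AP vsP)) wA.
Qed.

Let card_outer_Y y : y \in vertices Y ->
  #|[set A in edges T :\: edges P | y \in away T v0 A]| = dist T y v0.
Proof.
move=> yY; have yT : y \in vertices T by rewrite memT yY !orbT.
rewrite (dist_cuts (tree_cut_system trT v0T) (connT yT v0T)).
apply: eq_card => A; rewrite in_outer in_set setUC splits2.
have -> : v0 \in away T v0 A = false by rewrite inE connect0.
rewrite andbCA; congr (_ && _).
case yA: (y \in away T v0 A); last by rewrite andbF.
rewrite andbT; apply/negP => AP; move: yA; apply/negP; apply: Y_not_away => //.
by apply: contraTN AP => /YnP->.
Qed.

Let exchange (S S' : {set V}) :
    S \subset S' -> S' \subset vertices T -> #|S| < #|S'| -> 2 <= #|S'| ->
  exists S'' : {set V},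
    [/\ S \subset S'', S'' \subset vertices T, #|S''| = #|S'| &
        steiner T' S' <= steiner T S''].
Proof.
move=> SS' S'T ltSS' card2; rewrite steiner_T' //.
have keep : inner cutT' S' <= inner cutT S' ->
    exists S'' : {set V},
      [/\ S \subset S'', S'' \subset vertices T, #|S''| = #|S'| &
          outer S' + inner cutT' S' <= steiner T S''].
  by move=> le; exists S'; split=> //; rewrite steiner_T // leq_add2l.
(* Without a vertex of [Z] other than [vs] in [S'], the cuts at [P] leave the same trace on [S'] in
   both trees, and [S'] itself will do. *)
have [/exists_inP[z zS /andP[zZ zvs]]|noZ] :=
    boolP [exists z in S', (z \in vertices Z) && (z != vs)]; last first.
  apply: keep; apply: subset_leq_card; apply/subsetP => A; rewrite !in_inner.
  case AP: (A \in edges P) => //=; rewrite /cutT /cutT' AP.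
  rewrite (@splits_eq_in _ (vertices X :|: vertices Z :|: beyond q A)) //.
  move=> x xS; rewrite setUAC [RHS]in_setU.
  case xZ: (x \in vertices Z); last by rewrite orbF.
  have /eqP -> : x == vs.
    by apply: contraNT noZ => xvs; apply/exists_inP; exists x; rewrite ?xZ.
  by rewrite inE vsX.
(* If [S'] also meets [Y] outside [v0], every edge of [P] separates [z] from that vertex in [T], and
   [S'] again will do. *)
have [/exists_inP[y yS /andP[yY yv0]]|noY] :=
    boolP [exists y in S', (y \in vertices Y) && (y != v0)].
  apply: keep; apply: subset_leq_card; apply/subsetP => A; rewrite !in_inner.
  case AP: (A \in edges P) => //= _; rewrite /cutT AP; apply/splitsP.
  exists z, y; rewrite !inE zZ orbT; split=> //.
  rewrite YXx // YZx //=; apply: contraNN yv0 => yb.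
  by rewrite -YPx //; apply: (@beyondP A); rewrite inE.
have {}noY x : x \in S' -> x \in vertices Y -> x = v0.
  move=> xS xY; apply/eqP; apply: contraNT noY => xv0.
  by apply/exists_inP; exists x; rewrite ?xY.
have [w wS' wS] : exists2 w, w \in S' & w \notin S.
  apply/subsetPn; apply: contraTN ltSS' => /subset_leq_card; by rewrite -leqNgt.
have [y [yY yv0 far]] := far_vertex.
have yS' : y \notin S' by apply: contraNN yv0 => /noY->.
have inS'' x : x \in S' -> x != w -> x \in y |: S' :\ w.
  by move=> xS xw; rewrite !inE xS xw orbT.
have yS'' : y \in y |: S' :\ w by rewrite setU11.
have S''T : y |: S' :\ w \subset vertices T.
  rewrite subUset sub1set memT yY !orbT /=.
  by apply: subset_trans S'T; apply: subsetDl.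
exists (y |: S' :\ w); split=> //.
- apply/subsetP => x xS; apply: inS''; first exact: (subsetP SS').
  by apply: contraNneq wS => <-.
- by rewrite cardsU1 inE (negPf yS') andbF (cardsD1 w S') wS'.
(* Edges of [P]: [y] lies on the near side of all their cuts. On the far side [a] serves unless it
   is the vertex [w] given up; then [z] differs from [w], being outside [cutT' A], and serves
   instead. *)
rewrite steiner_T //; apply: leq_add; last first.
  apply: subset_leq_card; apply/subsetP => A; rewrite !in_inner.
  case AP: (A \in edges P) => //=; rewrite /cutT /cutT' AP.
  case/splitsP => a [b [aS _ acut _]]; apply/splitsP.
  have ycut : y \notin vertices X :|: vertices Z :|: beyond q A.
    rewrite !in_setU YXx // YZx //=.
    by rewrite (disjointFr (Y_beyond AP) yY).
  have [eaw|aw] := eqVneq a w; last first.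
    by exists a, y; split=> //; [exact: inS'' | rewrite setUAC inE acut].
  exists z, y; split=> //; last by rewrite !in_setU zZ orbT.
  apply: inS'' => //; apply: contraTneq acut => ezw.
  rewrite in_setU eaw -ezw XZx // (negPf zvs) /=.
  apply: contraNN zvs => /beyondP; by rewrite ZPx.
(* Edges off [P]: [Dw] and [Dy] are those that cut [w], respectively [y], off from [v0]. The bound
   adds up [#|C' :&: Dw| <= #|Dw| <= #|Dy| = #|C'' :&: Dy|] and [C' :\: Dw \subset C'' :\: Dy]. *)
pose Dw := [set A in edges T :\: edges P | w \in away T v0 A].
pose Dy := [set A in edges T :\: edges P | y \in away T v0 A].
pose C' := [set A in edges T :\: edges P | splits (away T v0 A) S'].
pose C'' :=
  [set A in edges T :\: edges P | splits (away T v0 A) (y |: S' :\ w)].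
rewrite -[X in X <= _]/#|C'| -[X in _ <= X]/#|C''|.
(* Such an edge lies in [Y] and cuts off only vertices of [Y] other than [v0], none of which is in
   [S']. *)
have Dy_avoid A x : A \in Dy -> x \in S' -> x \notin away T v0 A.
  rewrite in_outer => /and3P[AP AT yA] xS.
  have [AY|AY] := boolP (A \in edges Y).
    apply/negP => /(away_Y AY (subsetP S'T _ xS)) /andP[/(noY _ xS)->].
    by rewrite eqxx.
  by rewrite (negPf (Y_not_away AY yY)) in yA.
have leD : #|Dw| <= #|Dy|.
  (* If [w] is on [P], or in [Y] and hence equal to [v0], then [Dw] is empty; in [X] or [Z] the
     choice of [y] as farthest applies. *)
  rewrite (card_outer_Y yY); have wT := subsetP S'T _ wS'.
  have := wT; rewrite memT => /or4P[wP|wX|wY|wZ].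
  - rewrite [#|_|](_ : _ = 0) //; apply/eqP; rewrite cards_eq0.
    apply/eqP/setP => A.
    rewrite in_outer in_set0; apply/negP => /and3P[AP _].
    by rewrite (negPf (path_not_away AP wP)).
  - by apply: leq_trans (card_outer_from_vs wT) _; apply: far; rewrite inE wX.
  - rewrite [#|_|](_ : _ = 0) //; apply/eqP; rewrite cards_eq0.
    apply/eqP/setP => A.
    rewrite in_outer in_set0 (noY w) //; apply/negP => /and3P[_ _].
    by rewrite inE connect0.
  - apply: leq_trans (card_outer_from_vs wT) _.
    by apply: far; rewrite inE wZ orbT.
have DyC : Dy \subset C''.
  apply/subsetP => A ADy; have := ADy; rewrite !in_outer => /and3P[-> -> yA] /=.
  (* As [S'] has at least two vertices, some [b] outlasts the removal of [w] and is separated from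
     [y]. *)
  have [b] : exists b, b \in S' :\ w.
    by apply/card_gt0P; move: card2; rewrite (cardsD1 w) wS'.
  case/setD1P=> bw bS; apply/splitsP; exists y, b.
  split=> //; first exact: inS''.
  exact: Dy_avoid.
have C'DC'' : C' :\: Dw \subset C'' :\: Dy.
  apply/subsetP => A /setDP[AC' ADw]; have := AC'.
  rewrite in_outer => /and3P[AP AT /splitsP[a [b [aS bS aA bA]]]].
  have ADy : A \notin Dy by apply: contraTN aA => /Dy_avoid->.
  have wA : w \notin away T v0 A by apply: contraNN ADw; rewrite in_outer AP AT.
  have yA : y \notin away T v0 A by apply: contraNN ADy; rewrite in_outer AP AT.
  rewrite in_setD ADy in_outer AP AT /=; apply/splitsP; exists a, y; split=> //.
  by apply: inS'' => //; apply: contraNneq wA => <-.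
rewrite -(cardsID Dw C') -(cardsID Dy C'') (setIidPr DyC).
apply: leq_add (subset_leq_card C'DC'').
exact: leq_trans (subset_leq_card (subsetIr _ _)) leD.
Qed.

Lemma steiner_ecc_sigma k (S : {set V}) : 2 <= k -> #|S| < k ->
  steiner_ecc k S T' <= steiner_ecc k S T.
Proof.
move=> k2 ltSk; apply/bigmax_leqP => S' /and3P[SS' S'T /eqP S'k].
have [||S'' [SS'' S''T S''k le]] := exchange SS' S'T; rewrite ?S'k //.
apply: leq_trans le _; apply: (leq_bigmax_cond (F := steiner T)).
by rewrite SS'' S''T S''k S'k eqxx.
Qed.

(** * Summing over all [k]-sets *)

Let double_count (R : pred {set V}) (Q : {set V} -> {set V} -> bool) :
  \sum_(S | R S) #|[set A in edges P | Q A S]|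
    = \sum_(A in edges P) #|[set S | R S && Q A S]|.
Proof.
rewrite (eq_bigr (fun S => \sum_(A in edges P) Q A S)); last first.
  move=> S _; rewrite -sum1dep_card big_mkcondr.
  by apply: eq_bigr => A _; case: (Q A S).
rewrite exchange_big; apply: eq_bigr => A _; rewrite -sum1dep_card big_mkcondr.
by apply: eq_bigr => S _; case: (Q A S).
Qed.

Let path_edge (i : 'I_(size p)) : {set V} := [set nth v0 q i; nth v0 q i.+1].

Let path_edge_in i : path_edge i \in edges P.
Proof. by apply/mem_path_edges; exists i. Qed.

Let sum_path_edges (F : {set V} -> nat) :
  \sum_(A in edges P) F A = \sum_(i < size p) F (path_edge i).
Proof.
rewrite -[RHS](@big_imset _ _ _ _ _ _ predT F) => [|i j _ _ eq_ij].
  apply: eq_bigl => A; apply/mem_path_edges/imsetP => [[i ip ->] | [i _ ->]].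
    by exists (Ordinal ip).
  by exists i.
apply/val_inj; rewrite /= -(find_path_edge uq (ltn_ord i)).
by rewrite -/(path_edge i) eq_ij find_path_edge.
Qed.

Let x := #|vertices X|.
Let y := #|vertices Y|.
Let z := #|vertices Z :\ vs|.

(** [vs] lies both in [X] and beyond every edge, hence [i.+1] rather than [i]. *)
Let card_cutT' (i : 'I_(size p)) : #|cutT' (path_edge i)| = x + (size p - i.+1).
Proof.
rewrite /cutT' path_edge_in cardsU card_beyond //.
have -> : vertices X :&: beyond q (path_edge i) = [set vs].
  apply/setP => u; rewrite in_setI in_set1.
  apply/andP/eqP => [[uX /beyondP] | ->].
    by rewrite XPx // => /eqP.
  by rewrite vsX beyond_vs.
by rewrite cards1 -addnBA ?subn_gt0 ?ltn_ord // subn1 -subnS.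
Qed.

Let card_cutT (i : 'I_(size p)) :
  #|cutT (path_edge i)| = x + z + (size p - i.+1).
Proof.
rewrite addnAC -card_cutT' /cutT /cutT' path_edge_in.
have -> : vertices X :|: vertices Z :|: beyond q (path_edge i) =
    vertices X :|: beyond q (path_edge i) :|: (vertices Z :\ vs).
  apply/setP => u; rewrite !in_setU in_setD1.
  by case: eqP => [->|_]; rewrite ?vsX // orbAC.
rewrite cardsU; set I := _ :&: _; rewrite (_ : I = set0) ?cards0 ?subn0 //.
apply/setP => u; rewrite in_setI in_setD1 in_set0 in_setU.
apply/negP => /andP[/orP[uX|/beyondP uq'] /andP[uvs uZ]].
  by move: uX; rewrite XZx // (negPf uvs).
by move: uq'; rewrite ZPx // (negPf uvs).
Qed.

Let cutT_sub i : cutT (path_edge i) \subset vertices T.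
Proof.
apply/subsetP => u; rewrite /cutT path_edge_in !in_setU memT -orbA.
by case/or3P=> [->|->|/beyondP->]; rewrite ?orbT.
Qed.

Let cutT'_sub i : cutT' (path_edge i) \subset vertices T.
Proof.
apply/subsetP => u; rewrite /cutT' path_edge_in in_setU memT.
by case/orP=> [->|/beyondP->]; rewrite ?orbT.
Qed.

Let card_vertices : #|vertices T| = x + z + (size p).-1 + y.
Proof.
(* The first edge of [P] cuts [T] into [Y] and the rest, whose size is given by [card_cutT]. *)
have p0 : 0 < size p := sf_length sf; pose o := Ordinal p0.
have -> : (size p).-1 = size p - o.+1 by rewrite subn1.
rewrite -card_cutT; have -> : vertices T = cutT (path_edge o) :|: vertices Y.
  apply/setP => u; rewrite memT /cutT path_edge_in !in_setU.
  have [->|nu] := eqVneq u v0; first by rewrite v0Y !orbT.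
  have -> : (u \in beyond q (path_edge o)) = (u \in q).
    case uP: (u \in q); last by apply/negP => /beyondP; rewrite uP.
    by rewrite mem_beyond //= eq_sym (negPf nu).
  by move: (u \in q) (_ \in _) (_ \in _) (_ \in _) => [] [] [] [].
rewrite cardsU; set I := _ :&: _; rewrite (_ : I = set0) ?cards0 ?subn0 //.
apply/setP => u; rewrite in_setI in_set0 /cutT path_edge_in !in_setU.
apply/negP => /andP[ucut uY]; move: ucut; rewrite YXx // YZx //=.
by rewrite (disjointFr (Y_beyond (path_edge_in o)) uY).
Qed.

(** The other side consists of [Y] and the path vertices of index 1 to [i], which gives [y + i]. *)
Let card_splits_cutT k (i : 'I_(size p)) : 0 < k ->
  #|[set S : {set V} | (S \subset vertices T) && (#|S| == k)
                       && splits (cutT (path_edge i)) S]|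
   + ('C(x + z + (size p - i.+1), k) + 'C(y + i, k)) = 'C(#|vertices T|, k).
Proof.
move=> k0; rewrite -(card_splits k0 (cutT_sub i)); congr (_ + (_ + _)).
- by apply: eq_card => S; rewrite !in_set andbA.
- by rewrite card_cutT.
- rewrite cardsDS ?cutT_sub // card_cutT card_vertices; congr 'C(_, k).
  move: (ltn_ord i); move: (size p) (i : nat) x y z => s j a b c; clear; lia.
Qed.

Let card_splits_cutT' k (i : 'I_(size p)) : 0 < k ->
  #|[set S : {set V} | (S \subset vertices T) && (#|S| == k)
                       && splits (cutT' (path_edge i)) S]|
   + ('C(x + (size p - i.+1), k) + 'C(y + z + i, k)) = 'C(#|vertices T|, k).
Proof.
move=> k0; rewrite -(card_splits k0 (cutT'_sub i)); congr (_ + (_ + _)).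
- by apply: eq_card => S; rewrite !in_set andbA.
- by rewrite card_cutT'.
- rewrite cardsDS ?cutT'_sub // card_cutT' card_vertices; congr 'C(_, k).
  move: (ltn_ord i); move: (size p) (i : nat) x y z => s j a b c; clear; lia.
Qed.

Lemma sum_steiner_sigma k : 0 < k ->
  \sum_(S : {set V} | (S \subset vertices T) && (#|S| == k)) steiner T' S
    <= \sum_(S : {set V} | (S \subset vertices T) && (#|S| == k)) steiner T S.
Proof.
move=> k0.
rewrite (eq_bigr _ (fun S hS => steiner_T' (proj1 (andP hS)))).
rewrite [X in _ <= X](eq_bigr _ (fun S hS => steiner_T (proj1 (andP hS)))).
rewrite !big_split leq_add2l /inner !double_count !sum_path_edges.
(* Reversing the order of the edges turns the far sides into [a + i], so that convexity applies for
   each [i] with tops [x + i] and [y + i]. *)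
have revsum a : \sum_(i < size p) 'C(a + (size p - i.+1), k)
    = \sum_(i < size p) 'C(a + i, k) by rewrite [RHS](reindex_inj rev_ord_inj).
set N' := \sum_(i < size p) #|_|; set N := \sum_(i < size p) #|_|.
have sumN : N + (\sum_(i < size p) 'C(x + z + i, k)
                 + \sum_(i < size p) 'C(y + i, k))
    = \sum_(i < size p) 'C(#|vertices T|, k).
  rewrite -(revsum (x + z)) -!big_split; apply: eq_bigr => i _.
  exact: card_splits_cutT.
have sumN' : N' + (\sum_(i < size p) 'C(x + i, k)
                   + \sum_(i < size p) 'C(y + z + i, k))
    = \sum_(i < size p) 'C(#|vertices T|, k).
  rewrite -(revsum x) -!big_split; apply: eq_bigr => i _.
  exact: card_splits_cutT'.
have : \sum_(i < size p) 'C(x + z + i, k) + \sum_(i < size p) 'C(y + i, k)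
    <= \sum_(i < size p) 'C(x + i, k) + \sum_(i < size p) 'C(y + z + i, k).
  rewrite -!big_split /=; apply: leq_sum => i _.
  rewrite addnC -!(addnAC _ i); apply: bin_convex.
  by rewrite leq_add2r; apply: sf_card sf.
(* Split and unsplit sets have the same total in both trees, so no more unsplit ones in [T] means no
   fewer split ones. *)
by move=> le; rewrite -(leq_add2r (\sum_(i < size p) 'C(x + i, k)
  + \sum_(i < size p) 'C(y + z + i, k))) sumN' -sumN leq_add2l.
Qed.

End SigmaForm.

(** * From sums to averages *)

Lemma steiner_ecc_full (V : finType) (G : graph V) (S : {set V}) :
  S \subset vertices G -> steiner_ecc #|S| S G = steiner G S.
Proof.
move=> SG; rewrite /steiner_ecc (big_pred1 S) // => S' /=.
apply/and3P/eqP => [[SS' _ /eqP S'S] | ->]; last by rewrite subxx eqxx.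
by apply/esym/eqP; rewrite eqEcard SS' S'S leqnn.
Qed.

Theorem theorem1 (k l n : nat) (V : finType) (T X Y Z P : graph V)
    (v0 vs : V) (s : nat) (T' : graph V)
    (hk : (2 <= k)%N) (hl : (l <= k)%N)
    (hT : is_tree T) (hn : #|vertices T| = n) (hkn : (k < n)%N)
    (hstar : ~ isomorphic T (complete_bipartite 1 n.-1))
    (hsigma : sigma_form T X Y Z P v0 vs s)
    (hT' : T' = sigma T Z v0 vs) :
  (avg_steiner_ecc k l T >= avg_steiner_ecc k l T')%R.
Proof.
have [p [uq lq ps eP]] := sf_path hsigma; subst s P T'.
have k0 : 0 < k by apply: leq_trans hk.
rewrite /avg_steiner_ecc.
(* [sigma] keeps the vertex set, so both averages carry the same nonnegative factor and only the
   sums are compared. *)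
apply: Num.Theory.ler_wpM2l.
  by rewrite Num.Theory.invr_ge0 Num.Theory.ler0n.
rewrite -!GRing.natr_sum Num.Theory.ler_nat.
have [ltlk|] := ltnP l k.
  apply: leq_sum => S /andP[_ /eqP Sl].
  by apply: (steiner_ecc_sigma hT uq lq hsigma hk); rewrite Sl.
move=> lekl; have -> : l = k by apply/eqP; rewrite eqn_leq hl lekl.
have ecc_steiner G : vertices G = vertices T ->
    \sum_(S : {set V} | (S \subset vertices G) && (#|S| == k)) steiner_ecc k S G
    = \sum_(S : {set V} | (S \subset vertices T) && (#|S| == k)) steiner G S.
  move=> <-; apply: eq_bigr => S /andP[SG /eqP <-]; exact: steiner_ecc_full.
rewrite !ecc_steiner //; exact: (sum_steiner_sigma hT uq lq hsigma k0).
Qed.
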